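(* In a multipass pairing heap, the amortized time of the delete-min operation is $O(\log n \cdot \log^{\ast} n \cdot 2^{\log^{\ast} n})$, where $n$ is the number of items in the heap.
   Context: A pairing heap is a rooted multi-ary tree storing one key per node (keys distinct) in heap order: the key of every node is smaller than the keys of its children. The unit-cost operation $\mathsf{link}(x,y)$ on two roots makes the one with the larger key the leftmost child of the other. Delete-min in a multipass pairing heap: delete the root; its children $x_1,\dots,x_\ell$ (ordered left to right) become the top-level nodes; then repeatedly perform pairing rounds until a single top-level node remains (the new root). A pairing round on top-level nodes $x_1,\dots,x_\ell$ performs $\mathsf{link}(x_{2i-1},x_{2i})$ for all $1\le i\le\lfloor \ell/2\rfloor$ (if $\ell$ is odd the rightmost node is untouched), the resulting top-level nodes keeping their left-to-right order. The actual cost of a delete-min is the number $k$ of children of the deleted root (there are exactly $k-1$ links). Amortized time is in the standard sense of amortized analysis (via a potential function on heaps). $\log^{\ast}$ denotes the iterated logarithm; $\log$ is base 2. *)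

(* Defs.v *)
From HB Require Import structures.
From mathcomp Require Import all_boot all_order all_algebra.
From mathcomp Require Import zify.
From mathcomp Require Import reals exp.

Set Implicit Arguments.
Unset Strict Implicit.
Unset Printing Implicit Defensive.

Import Order.TTheory GRing.Theory Num.Theory.

Local Open Scope ring_scope.

(* Children are listed from left to right. *)
Inductive tree (K : Type) : Type := Node of K & seq (tree K).

Section PairingHeap.
Context {disp : Order.disp_t} {K : orderType disp}.
Implicit Types (t : tree K) (s : seq (tree K)).

Definition root_key t : K := let: Node x _ := t in x.

Definition children t : seq (tree K) := let: Node _ s := t in s.

Fixpoint keys t : seq K :=
  let: Node x s := t in x :: flatten (map keys s).

Fixpoint heap_ordered t : bool :=
  let: Node x s := t in
  all (fun c => (x < root_key c)%O && heap_ordered c) s.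

Definition is_heap t : bool := heap_ordered t && uniq (keys t).

Definition link t u : tree K :=
  if (root_key t < root_key u)%O then Node (root_key t) (u :: children t)
  else Node (root_key u) (t :: children u).

Fixpoint pairing_round s : seq (tree K) :=
  if s is t :: u :: s' then link t u :: pairing_round s' else s.

(* A round strictly shortens every list of at least two trees and leaves shorter
   lists unchanged, so [size s] rounds amount to iterating until a single tree
   remains; see [size_multipass]. *)
Definition multipass s : seq (tree K) := iter (size s) pairing_round s.

(* [None] is the empty heap. *)
Definition delete_min t : option (tree K) := ohead (multipass (children t)).

Definition delete_min_cost t : nat := size (children t).

Definition insert (x : K) (h : option (tree K)) : option (tree K) :=
  if h is Some t then Some (link (Node x [::]) t) else Some (Node x [::]).

Definition heap_keys (h : option (tree K)) : seq K :=
  if h is Some t then keys t else [::].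

Definition is_heap_opt (h : option (tree K)) : bool :=
  if h is Some t then is_heap t else true.

Lemma size_pairing_round s : size (pairing_round s) = uphalf (size s).
Proof.
have [n] := ubnP (size s); elim: n s => // n IHn [|t [|u s]] //= sn.
by rewrite IHn //; lia.
Qed.

Lemma size_multipass s : size (multipass s) = (0 < size s)%N.
Proof.
have shrink n : (size (iter n pairing_round s) <= maxn (size s - n) 1)%N.
  elim: n => [|n IHn] /=; first by lia.
  by rewrite size_pairing_round uphalfE -divn2; lia.
have pos n : (0 < size (iter n pairing_round s))%N = (0 < size s)%N.
  by elim: n => //= n <-; rewrite size_pairing_round uphalfE -divn2; lia.
by have := shrink (size s); have := pos (size s); rewrite /multipass; lia.
Qed.

End PairingHeap.

Section IteratedLog.
Variable R : realType.

Definition log2 (x : R) : R := ln x / ln 2.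

Lemma log_star_exists (n : nat) : exists k, iter k log2 n%:R <= 1.
Proof.
have ln2 : 0 < ln 2 :> R by rewrite ln_gt0 // ltr1n.
suff H k (x : R) : x <= k.+1%:R -> iter k log2 x <= 1.
  by exists n; apply: H; rewrite ler_nat.
elim: k x => [//|k IHk] x xk; rewrite iterSr; apply: IHk.
have [x0|x0] := leP x 0; first by rewrite /log2 ln0 // mul0r.
rewrite /log2 ler_pdivrMr // mulr_natl -lnXn // ler_ln ?posrE ?exprn_gt0 //.
by apply: le_trans xk _; rewrite -natrX ler_nat ltn_expl.
Qed.

Definition log_star (n : nat) : nat := ex_minn (log_star_exists n).

Definition delete_min_bound (n : nat) : R :=
  log2 n%:R * (log_star n)%:R * 2 ^+ log_star n.

End IteratedLog.

(* [c] is the actual cost of the operation turning the heap [h] into [h']. *)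
Definition amortized_cost (R : realType) (K : Type) (Phi : option (tree K) -> R)
  (c : nat) (h h' : option (tree K)) : R := c%:R + Phi h' - Phi h.

(* A bound on the amortized cost of [delete_min] alone would say nothing: taking
   for [Phi] the cost of emptying the heap by successive calls to [delete_min]
   makes that amortized cost 0.  As usual, the potential is therefore accounted
   for from the empty heap, which has potential 0, and the insertions building
   the heaps are charged for the potential that they create. *)
Definition admissible_potential (R : realType) (disp : Order.disp_t)
    (K : orderType disp) (Phi : option (tree K) -> R) (C : R) : Prop :=
  [/\ Phi None = 0,
      forall h, is_heap_opt h -> 0 <= Phi h
    & forall x h, is_heap_opt h -> x \notin heap_keys h ->
        amortized_cost Phi 1 h (insert x h)
          <= C * (1 + delete_min_bound R (size (heap_keys h)))].

(* Main.v *)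
Require Import Defs.
From mathcomp Require Import all_boot all_order all_algebra.
From mathcomp Require Import zify ring lra.
From mathcomp Require Import reals exp.

(* Only the shape of the heap matters, not its keys.  A child of size s that
   has size w together with its parent and older siblings contributes about
   F (log (w / s)) to the potential, where F is concave and its slope at v is
   2 / T for the largest tower T <= v of powers of 2.  Consider a link of two
   adjacent trees of sizes x and y, followed by trees of total size z, and let
   e = log ((x + y + z) / (x + y)).  The log-ratio of the loser was at least
   d + e - 1 and becomes d, so if e >= 2 then either the potential drops by 1,
   or e lies below a tower that d + e - 1 has reached.  In the second case the
   tower level of the new top-level tree is below that of the loser; this
   cannot happen everywhere for log* n + 1 consecutive rounds.  Hence, up to the
   links with e < 2, a list of k trees yields a drop by k / 2 ^ (log* n + 1).
   A link with e < 2 may increase the potential, but then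
   log (x + y + z) - log z is bounded below, and these differences telescope to
   at most log n in each round.  As long as there are more than log n trees, the
   increase of O(log n) per round is absorbed by the drop; with log n / 2 ^ i
   trees left, the tangent of F at 2 ^ i bounds the increase by O(log n) times
   the slope at 2 ^ i, up to a geometric term, and these slopes sum to
   O(log* n).  Scaling the potential by 2 ^ log* n lets the drop pay for all
   the links. *)

Set Implicit Arguments.
Unset Strict Implicit.
Unset Printing Implicit Defensive.

Import Order.TTheory GRing.Theory Num.Theory.

Local Open Scope ring_scope.

(** * Towers of powers of 2, and integer logarithms of ratios *)

Section Tower.
Local Open Scope nat_scope.

Definition tower (i : nat) : nat := iter i (expn 2) 1.

Lemma tower_gt0 i : 0 < tower i.
Proof. by case: i => // i; rewrite /= expn_gt0. Qed.

Lemma ltn_tower i : i < tower i.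
Proof. by elim: i => //= i IHi; apply: (leq_ltn_trans IHi); apply: ltn_expl. Qed.

Lemma leq_tower i j : i <= j -> tower i <= tower j.
Proof.
move=> /subnK <-; elim: (j - i) => //= k IHk.
by apply: (leq_trans IHk); apply/ltnW/ltn_expl.
Qed.

Lemma tower_level_exists v : exists i, v < tower i.+1.
Proof. by exists v; apply: ltnW (ltn_tower v.+1). Qed.

(** For [v > 0] this is the index of the largest tower at most [v]; comparing with the next tower
    puts [v = 0] at level 0 as well. *)
Definition tower_level (v : nat) : nat := ex_minn (tower_level_exists v).

Lemma tower_level_lt v : v < tower (tower_level v).+1.
Proof. by rewrite /tower_level; case: ex_minnP. Qed.

Lemma tower_level_min v i : v < tower i.+1 -> tower_level v <= i.
Proof. by rewrite /tower_level; case: ex_minnP => j _ /(_ i). Qed.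

Lemma tower_level_le v : 0 < v -> tower (tower_level v) <= v.
Proof.
move=> v0; case def_i: (tower_level v) => [//|i].
by rewrite leqNgt; apply: contraTN (leqnn i.+1) => /tower_level_min; rewrite def_i -ltnNge ltnS.
Qed.

Lemma leq_tower_level u v : u <= v -> tower_level u <= tower_level v.
Proof. by move=> uv; apply/tower_level_min/(leq_ltn_trans uv)/tower_level_lt. Qed.

Lemma tower_level_ltP v i : v < tower i.+1 <-> tower_level v <= i.
Proof.
split; first exact: tower_level_min.
by move=> vi; apply: leq_trans (tower_level_lt v) _; apply: leq_tower.
Qed.

(** The floor of log (w / s) when [0 < s <= w]: truncating the quotient first does not change it. *)
Definition ilog (w s : nat) : nat := trunc_log 2 (w %/ s).

Lemma ilog_ge w s m : 0 < s -> 2 ^ m * s <= w -> m <= ilog w s.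
Proof.
move=> s0 H; rewrite /ilog -(trunc_expnK m (isT : 1 < 2)).
by apply: leq_trunc_log; rewrite leq_divRL.
Qed.

Lemma ilog_le w s : 0 < s <= w -> 2 ^ ilog w s * s <= w.
Proof.
by move=> /andP[s0 sw]; rewrite -leq_divRL // trunc_logP // divn_gt0.
Qed.

Lemma ilog_gt w s : 0 < s -> w < 2 ^ (ilog w s).+1 * s.
Proof. by move=> s0; rewrite -ltn_divLR // trunc_log_ltn. Qed.

(** * Log-ratios around a link of adjacent trees of sizes [x] and [y]; [z] counts the parent and the
    later siblings *)

Section Pair.
Variables x y z : nat.
Hypotheses (x0 : 0 < x) (y0 : 0 < y) (z0 : 0 < z).
Let e := ilog (x + y + z) (x + y).

Lemma ilog_pair_l : e <= ilog (x + y + z) x.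
Proof.
apply: ilog_ge => //; have /ilog_le : 0 < x + y <= x + y + z by lia.
rewrite -/e; nia.
Qed.

Lemma ilog_pair_r : e <= ilog (y + z) y.
Proof.
apply: ilog_ge => //; have /ilog_le : 0 < x + y <= x + y + z by lia.
rewrite -/e; have : 0 < 2 ^ e by rewrite expn_gt0.
case: (2 ^ e) => // p _; nia.
Qed.

Lemma ilog_pair_addl : ilog (x + y) x + e <= ilog (x + y + z) x.
Proof.
apply: ilog_ge => //; have /ilog_le : 0 < x + y <= x + y + z by lia.
have /ilog_le : 0 < x <= x + y by lia.
by rewrite -/e expnD; nia.
Qed.

(** The old ratio of [y] leaves out [x], which costs 1: [y + z] is still at least
    [(2 ^ e - 1) * (x + y)], hence at least [2 ^ e.-1 * (x + y)]. *)
Lemma ilog_pair_addr : 2 <= e -> ilog (x + y) y + e.-1 <= ilog (y + z) y.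
Proof.
case de: e => [|e'] //= e2; apply: ilog_ge => //.
have /ilog_le : 0 < x + y <= x + y + z by lia.
have /ilog_le : 0 < y <= x + y by lia.
rewrite -/e de expnD expnS; have : 2 <= 2 ^ e' by rewrite -{1}(expn1 2) leq_exp2l.
nia.
Qed.

(** Since [(x + y) * z <= (y + z) * (x + y + z)], the ratio (x + y) / y is at most the product of
    the other two; the successor absorbs the rounding. *)
Lemma ilog_pair_small :
  ilog (x + y) y <= ilog (y + z) y + (ilog (x + y + z) z).+1.
Proof.
rewrite -ltnS -addSn -(ltn_exp2l _ _ (isT : 1 < 2)).
have /ilog_le : 0 < y <= x + y by lia.
have := ilog_gt (y + z) y0; have := ilog_gt (x + y + z) z0.
rewrite expnD.
set a := 2 ^ _.+1; set b := 2 ^ _.+1; set c := 2 ^ _ => Hb Ha Hc.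
rewrite -(ltn_pmul2r (_ : 0 < y * z)) ?muln_gt0 ?y0 //.
have H1 : c * (y * z) <= (x + y) * z by nia.
have H2 : (x + y) * z <= (y + z) * (x + y + z) by nia.
have H3 : (y + z) * (x + y + z) < (b * y) * (a * z) by apply: ltn_mul.
lia.
Qed.

(** The pair holds more than a quarter of the weight, so log (x + y + z) - log z exceeds log (4 /
    3). *)
Lemma small_pair : e <= 1 -> 4 * z < 3 * (x + y + z).
Proof.
move=> e1; have : 0 < x + y by lia.
move/(ilog_gt (x + y + z)); rewrite -/e => H.
have : x + y + z < 4 * (x + y); last lia.
apply: leq_trans H _; rewrite leq_mul2r; apply/orP; right.
by rewrite -[4]/(2 ^ 2) leq_exp2l.
Qed.

End Pair.
End Tower.

(** * Real base-2 logarithms and the iterated logarithm *)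

Section Log2.
Variable R : realType.

Lemma ln2_gt0 : 0 < ln 2 :> R.
Proof. by rewrite ln_gt0 // ltr1n. Qed.

Lemma log2_0 : log2 0 = 0 :> R.
Proof. by rewrite /log2 ln0 // mul0r. Qed.

Lemma log2_1 : log2 1 = 0 :> R.
Proof. by rewrite /log2 ln1 mul0r. Qed.

Lemma log2_le (x y : R) : 0 < x -> x <= y -> log2 x <= log2 y.
Proof.
move=> x0 xy; rewrite /log2 ler_pM2r ?invr_gt0 ?ln2_gt0 // ler_ln ?posrE //.
exact: lt_le_trans xy.
Qed.

Lemma log2M (x y : R) : 0 < x -> 0 < y -> log2 (x * y) = log2 x + log2 y.
Proof. by move=> x0 y0; rewrite /log2 lnM ?posrE // mulrDl. Qed.

Lemma log2X k : log2 (2 ^+ k) = k%:R :> R.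
Proof. by rewrite /log2 lnXn // -[ln 2 *+ k]mulr_natl mulfK // gt_eqF // ln2_gt0. Qed.

Lemma log2_nat_ge0 n : 0 <= log2 n%:R :> R.
Proof.
case: n => [|n]; first by rewrite log2_0.
by rewrite -log2_1 log2_le // ler1n.
Qed.

Lemma le_log2_nat (m n : nat) : (m <= n)%N -> log2 m%:R <= log2 n%:R :> R.
Proof.
case: m => [|m] mn; first by rewrite log2_0 log2_nat_ge0.
by rewrite log2_le // ler_nat.
Qed.

Lemma ilog_le_log2 (w s n : nat) :
  (0 < s <= w)%N -> (w <= n)%N -> (ilog w s)%:R <= log2 n%:R :> R.
Proof.
move=> sw wn; rewrite -log2X log2_le ?exprn_gt0 // -natrX ler_nat.
have := ilog_le sw; have /andP[s0 _] := sw; nia.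
Qed.

Lemma log2_succ_le n : (0 < n)%N -> log2 n.+1%:R <= 1 + log2 n%:R :> R.
Proof.
move=> n0; have e : log2 2 = 1 :> R by exact: (log2X 1).
apply: (@le_trans _ _ (log2 (2 * n%:R))); last by rewrite log2M ?ltr0n // e.
by rewrite log2_le ?ltr0n // -(natrM _ 2) ler_nat; lia.
Qed.

Lemma leq_tower_log_star n : (n <= tower (log_star R n))%N.
Proof.
rewrite /log_star; case: ex_minnP => k + _; rewrite -(ler_nat R).
elim: k (n%:R : R) => [//|k IHk] x; rewrite iterSr => /IHk H.
have [x0|x0] := leP x 0; first exact: le_trans x0 _.
have ln20 := ln2_gt0; move: H; rewrite /log2 ler_pdivrMr // mulr_natl -lnXn //.
by rewrite ler_ln ?posrE ?exprn_gt0 // /= natrX.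
Qed.

Lemma log_star_gt0 n : (1 < n)%N -> (0 < log_star R n)%N.
Proof. by have := leq_tower_log_star n; case: (log_star R n) => //=; lia. Qed.

Lemma tower_level_le_log_star n : (0 < n)%N -> (tower_level n <= log_star R n)%N.
Proof.
move=> n0; have := leq_tower_log_star n; set k := log_star R n => nk.
rewrite -tower_level_ltP; apply: leq_ltn_trans nk _; exact: ltn_expl.
Qed.

End Log2.

(** * The concave function F applied to log-ratios *)

Section Weight.
Variable R : realType.

Definition slope (v : nat) : R := 2 / (tower (tower_level v))%:R.

Definition logweight (u : nat) : R := \sum_(v < u) slope v.

Lemma slope_gt0 v : 0 < slope v.
Proof. by rewrite /slope divr_gt0 // ltr0n tower_gt0. Qed.

Lemma slope_ge0 v : 0 <= slope v.
Proof. exact/ltW/slope_gt0. Qed.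

Lemma slope_le2 v : slope v <= 2.
Proof.
rewrite /slope ler_pdivrMr ?ltr0n ?tower_gt0 // ler_peMr //.
by rewrite ler1n tower_gt0.
Qed.

Lemma slope_anti u v : (u <= v)%N -> slope v <= slope u.
Proof.
move=> uv; rewrite /slope ler_pM2l // lef_pV2 ?posrE ?ltr0n ?tower_gt0 //.
by rewrite ler_nat; apply/leq_tower/leq_tower_level.
Qed.

Lemma logweight0 : logweight 0 = 0.
Proof. by rewrite /logweight big_ord0. Qed.

Lemma logweightS u : logweight u.+1 = logweight u + slope u.
Proof. by rewrite /logweight big_ord_recr. Qed.

Lemma logweight_ge0 u : 0 <= logweight u.
Proof. by apply: sumr_ge0 => v _; apply: slope_ge0. Qed.

Lemma le_logweight u v : (u <= v)%N -> logweight u <= logweight v.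
Proof.
move/subnK => <-; elim: (v - u)%N => //= k IHk.
by rewrite addSn logweightS; have := slope_ge0 (k + u); lra.
Qed.

Lemma logweight_tangent v w : logweight (v + w) <= logweight v + slope v * w%:R.
Proof.
elim: w => [|w IHw]; first by rewrite addn0 mulr0 addr0.
rewrite addnS logweightS -natr1 mulrDr mulr1.
by have := slope_anti (leq_addr w v); lra.
Qed.

Lemma logweight_gain v w :
  logweight v + slope (v + w) * w%:R <= logweight (v + w).
Proof.
elim: w => [|w IHw]; first by rewrite addn0 mulr0 addr0.
rewrite addnS logweightS -natr1 mulrDr mulr1.
have sw := slope_anti (leqnSn (v + w)).
have : slope (v + w).+1 * w%:R <= slope (v + w) * w%:R by rewrite ler_wpM2r.
lra.
Qed.

Lemma logweight_le u : logweight u <= 2 * u%:R.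
Proof.
have := logweight_tangent 0 u; rewrite add0n logweight0 add0r.
by move/le_trans; apply; rewrite ler_wpM2r // slope_le2.
Qed.

Lemma logweight_subadd u w : logweight (u + w) <= logweight u + logweight w.
Proof.
elim: w => [|w IHw]; first by rewrite addn0 logweight0 addr0.
rewrite addnS !logweightS.
by have := slope_anti (leq_addl u w); lra.
Qed.

Lemma logweight_le_tangent v w : logweight w <= logweight v + slope v * w%:R.
Proof.
apply: le_trans (logweight_tangent v w).
by apply: le_logweight; apply: leq_addl.
Qed.

(** Each tower interval contributes at most 2: for [r] from [tower i] up to [tower i.+1], the point
    [2 ^ r] is at least [tower i.+1], so its slope is at most [2 / tower i.+1], and there are at
    most [tower i.+1] such [r]. *)
Lemma sum_slope_exp2 m i :
  (m <= tower i)%N -> \sum_(r < m) slope (2 ^ r)%N <= 2 * i.+1%:R.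
Proof.
elim: i m => [|i IHi] m mi.
  case: m mi => [|[|//]] _; first by rewrite big_ord0 mulr1.
  by rewrite big_ord1 mulr1 slope_le2.
have [mT|Tm] := leqP m (tower i).
  by apply: le_trans (IHi _ mT) _; rewrite ler_pM2l // ler_nat.
rewrite -(subnKC (ltnW Tm)) big_split_ord /=.
rewrite -[i.+2%:R]natr1 mulrDr mulr1; apply: lerD; first exact: IHi.
set q := (m - tower i)%N.
apply: (@le_trans _ _ (\sum_(r < q) 2 / (2 ^ tower i)%:R)); last first.
  rewrite sumr_const card_ord -[_ *+ q]mulr_natr -mulrA ler_piMr // mulrC.
  rewrite ler_pdivrMr ?ltr0n ?expn_gt0 //.
  by rewrite mul1r ler_nat; move: mi; rewrite /= /q; lia.
apply: ler_sum => r _; apply: le_trans (slope_anti (_ : tower i.+1 <= _)%N) _.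
  by rewrite /= leq_exp2l // leq_addr.
rewrite /slope ler_pM2l // lef_pV2 ?posrE ?ltr0n ?tower_gt0 ?expn_gt0 //.
rewrite ler_nat -[(2 ^ tower i)%N]/(tower i.+1); apply: leq_tower.
rewrite leqNgt -ltnS; apply/negP => /tower_level_ltP.
by rewrite ltnn.
Qed.

End Weight.

(** * The potential of a forest and its change in one round *)

Section Potential.
Variables (R : realType) (disp : Order.disp_t) (K : orderType disp).
Implicit Types (t u : tree K) (s : seq (tree K)).
Local Notation f := (logweight R).

Definition weight t : nat := size (keys t).
Definition weights s : nat := sumn (map weight s).

Lemma weightE t : weight t = (weights (children t)).+1.
Proof.
by case: t => x s; rewrite /weight /= size_flatten /shape -map_comp.
Qed.

Lemma weight_gt0 t : (0 < weight t)%N.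
Proof. by rewrite weightE. Qed.

Lemma weights_cons t s : weights (t :: s) = (weight t + weights s)%N.
Proof. by []. Qed.

Section Forest.
Variable p : tree K -> R.
(** The successor counts the parent. Keeping [p] fixed outside the recursion lets [pot] recurse
    through lists of subtrees. *)
Fixpoint forest_sum s : R :=
  if s is t :: s' then
    f (ilog (weights (t :: s')).+1 (weight t)) + p t + forest_sum s'
  else 0.
End Forest.

Fixpoint pot t : R := let: Node _ s := t in forest_sum pot s.

Definition forest_pot s : R := forest_sum pot s.

Lemma potE t : pot t = forest_pot (children t).
Proof. by case: t. Qed.

Lemma forest_pot_cons t s :
  forest_pot (t :: s) =
  f (ilog (weights (t :: s)).+1 (weight t)) + pot t + forest_pot s.
Proof. by []. Qed.

(** Each node contributes at most 2 log n. Induction on the total weight covers both the subtrees of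
    the first tree and its later siblings. *)
Lemma forest_pot_bounds s (n : nat) : ((weights s).+1 <= n)%N ->
  0 <= forest_pot s <= 2 * (weights s)%:R * log2 n%:R.
Proof.
have [N] := ubnP (weights s); elim: N s => // N IHN [|t s].
  by rewrite mulr0 mul0r /forest_pot /= lexx.
have := weightE t; rewrite forest_pot_cons weights_cons potE => wt sN sn.
have /IHN : (weights (children t) < N)%N by lia.
have /IHN : (weights s < N)%N by lia.
move=> /(_ ltac:(lia)) /andP[s0 sb] /(_ ltac:(lia)) /andP[t0 tb].
have f0 := logweight_ge0 R (ilog (weight t + weights s).+1 (weight t)).
have fb := logweight_le R (ilog (weight t + weights s).+1 (weight t)).
have lb : (ilog (weight t + weights s).+1 (weight t))%:R <= log2 n%:R :> R.
  by apply: ilog_le_log2 => //; rewrite weight_gt0 /=; lia.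
have -> : (weight t + weights s)%:R = (weights (children t))%:R + 1 + (weights s)%:R :> R.
  by rewrite natrD [in LHS]wt natr1.
by apply/andP; split; lra.
Qed.

Lemma pot_ge0 t : 0 <= pot t.
Proof. by rewrite potE; have /andP[] := forest_pot_bounds (leqnn (weights (children t)).+1). Qed.

Lemma pot_le t : pot t <= 2 * (weight t)%:R * log2 (weight t)%:R.
Proof.
have := leqnn (weight t); rewrite {1}weightE => /forest_pot_bounds /andP[_].
rewrite -potE => /le_trans; apply.
rewrite ler_wpM2r ?log2_nat_ge0 // ler_pM2l // ler_nat weightE; lia.
Qed.

(** Abstracts from the keys: either tree may be the loser [l]. The loser becomes the leftmost child,
    and a log-ratio involves only later siblings, so the other children of the winner keep
    theirs. *)
Lemma link_caseE t u : exists w l, [/\ (w = t /\ l = u) \/ (w = u /\ l = t),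
  weight (link t u) = (weight t + weight u)%N
  & pot (link t u) =
      f (ilog (weight t + weight u) (weight l)) + pot t + pot u].
Proof.
have H w l : [/\ weight (Node (root_key w) (l :: children w)) = (weight w + weight l)%N
    & pot (Node (root_key w) (l :: children w)) =
      f (ilog (weight w + weight l) (weight l)) + pot w + pot l].
  have E : (weights (l :: children w)).+1 = (weight w + weight l)%N.
    by rewrite weights_cons (weightE w) addnC.
  split; first by rewrite weightE.
  rewrite [LHS]potE forest_pot_cons E (potE w); lra.
rewrite /link; case: ifP => _.
  by have [e1 e2] := H t u; exists t, u; split => //; left.
have [e1 e2] := H u t; exists u, t; split; [by right | by rewrite e1 addnC|].
by rewrite e2 addnC; lra.
Qed.

Fixpoint level_count (P : pred nat) s : R :=
  if s is t :: s' then
    (P (ilog (weights (t :: s')).+1 (weight t)))%:R + level_count P s'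
  else 0.

(** [d] and [w] are the new and old log-ratios of the loser. A new top-level tree satisfying [Q] is
    paid for by a drop of F, or by the loser having satisfied [P], or, in a link with [e < 2], by
    the linear bound [a + b * q.+1]. *)
Lemma link_weight_le x y z (P Q : pred nat) (a b : R) :
    (0 < x)%N -> (0 < y)%N -> (0 < z)%N -> 0 <= a -> 0 <= b ->
    (forall e d, (tower_level e < tower_level d)%N -> Q e -> P d) ->
    (forall q, 1 + f q.+1 <= a + b * q.+1%:R) ->
    forall d E1 E2 w,
      (d = ilog (x + y) x /\ w = E1) \/ (d = ilog (x + y) y /\ w = E2) ->
      E1 = ilog (x + y + z) x -> E2 = ilog (y + z) y ->
  f d + f (ilog (x + y + z) (x + y)) + (Q (ilog (x + y + z) (x + y)))%:R
  <= f E1 + f E2 + (P w)%:R + a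
     + 4 * b * (log2 (x + y + z)%:R - log2 z%:R).
Proof.
move=> x0 y0 z0 a0 b0 PQ fab d E1 E2 w Hd defE1 defE2.
set e := ilog _ (x + y).
have eE1 : (e <= E1)%N by rewrite defE1; apply: ilog_pair_l.
have eE2 : (e <= E2)%N by rewrite defE2; apply: ilog_pair_r.
set D := log2 _ - _; have D0 : 0 <= D by rewrite subr_ge0 le_log2_nat //; lia.
have bD0 : 0 <= b * D by apply: mulr_ge0.
have [e2|e1] := leqP 2 e.
  suff : f d + f e + (Q e)%:R <= f E1 + f E2 + (P w)%:R by lra.
  have [wd wmin] : (d + e.-1 <= w)%N /\ f w + f e <= f E1 + f E2.
    case: Hd => -[-> ->]; split.
    - by rewrite defE1; have := ilog_pair_addl x0 y0 z0; rewrite -/e; lia.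
    - by have := le_logweight R eE2; lra.
    - by rewrite defE2; apply: ilog_pair_addr.
    - by have := le_logweight R eE1; lra.
  have fw := le_logweight R wd; have g := logweight_gain R d e.-1.
  case Qe: (Q e); last first.
    by have := mulr_ge0 (slope_ge0 R (d + e.-1)) (ler0n R e.-1); case: (P w) => /=; lra.
  have [lev|lev] := ltnP (tower_level e) (tower_level w).
    rewrite (PQ _ _ lev Qe) /=.
    by have := mulr_ge0 (slope_ge0 R (d + e.-1)) (ler0n R e.-1); lra.
  suff : 1 <= slope R (d + e.-1) * e.-1%:R by case: (P w) => /=; lra.
  (* The level of [e] is not below that of [w], so the tower reached by [d + e.-1] is at most [e],
     and [e <= 2 * e.-1]; the 2 in [slope] thus makes the drop at least 1. *)
  have Te : (tower (tower_level (d + e.-1)) <= e)%N.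
    apply: leq_trans (tower_level_le (ltnW e2)); apply: leq_tower.
    by apply: leq_trans lev; apply: leq_tower_level.
  rewrite /slope mulrAC ler_pdivlMr ?ltr0n ?tower_gt0 // mul1r -natrM ler_nat.
  lia.
have z1 := small_pair x0 y0 z0 e1.
set q := ilog (x + y + z) z.
(* (4 / 3) ^ 3 > 2. Together with [q <= D] this gives [q + 1 <= 4 * D], the source of the factor
   4. *)
have D3 : 1 <= 3 * D.
  have e2 : log2 2 = 1 :> R by exact: (log2X R 1).
  have e3 k : (0 < k)%N -> log2 (k%:R ^+ 3) = 3 * log2 k%:R :> R.
    by move=> k0; rewrite /log2 lnXn ?ltr0n // -[ln _ *+ 3]mulr_natl mulrA.
  have : log2 2 + log2 (z%:R ^+ 3) <= log2 ((x + y + z)%:R ^+ 3) :> R.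
    rewrite -log2M ?exprn_gt0 ?ltr0n // log2_le ?mulr_gt0 ?exprn_gt0 ?ltr0n //.
    rewrite -!natrX -(natrM _ 2) ler_nat.
    by have := leq_exp2r (4 * z) (3 * (x + y + z)) (isT : 0 < 3)%N; rewrite !expnMn; lia.
  by rewrite e2 !e3 ?addn_gt0 ?x0 // /D; lra.
have qD : q%:R <= D.
  rewrite lerBrDr -(log2X _ q) -log2M ?exprn_gt0 ?ltr0n // log2_le //.
    by rewrite mulr_gt0 ?exprn_gt0 ?ltr0n.
  by rewrite -natrX -natrM ler_nat ilog_le // z0 /=; lia.
have fl : f d + f e <= f E1 + f E2 + f q.+1.
  case: Hd => -[-> _].
    have : (ilog (x + y) x <= E1)%N.
      by rewrite defE1; have := ilog_pair_addl x0 y0 z0; lia.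
    move/(le_logweight R); have := le_logweight R eE2.
    by have := logweight_ge0 R q.+1; lra.
  have := ilog_pair_small x0 y0 z0; rewrite -defE2 -/q => /(le_logweight R).
  have := le_logweight R eE1; have := logweight_subadd R E2 q.+1; lra.
have := fab q; rewrite -natr1.
have : (Q e)%:R <= 1 :> R by case: (Q e).
have : 0 <= (P w)%:R :> R by [].
have : b * (q%:R + 1) <= b * (4 * D) by apply: ler_wpM2l => //; lra.
lra.
Qed.

Lemma weights_round s : weights (pairing_round s) = weights s.
Proof.
have [N] := ubnP (size s); elim: N s => // N IHN [|t [|u s]] //= sN.
rewrite !weights_cons IHN; last by lia.
by have [w [l [_ -> _]]] := link_caseE t u; rewrite addnA.
Qed.

Lemma level_count_ge0 P s : 0 <= level_count P s.
Proof. by elim: s => //= t s IHs; rewrite addr_ge0. Qed.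

Lemma level_count_pred0 s : level_count pred0 s = 0.
Proof. by elim: s => //= t s ->; rewrite addr0. Qed.

Lemma level_count_le_size P s : level_count P s <= (size s)%:R.
Proof.
by elim: s => //= t s IHs; rewrite -natr1 addrC lerD //; case: (P _).
Qed.

Lemma level_count_predT s : level_count predT s = (size s)%:R.
Proof. by elim: s => //= t s ->; rewrite [RHS]mulrS. Qed.

(** Sums the bounds of the single links; the logarithm differences telescope, and the final 1 pays
    for counting an unpaired last tree. *)
Lemma round_pot_le (P Q : pred nat) (a b : R) s :
    0 <= a -> 0 <= b ->
    (forall e d, (tower_level e < tower_level d)%N -> Q e -> P d) ->
    (forall q, 1 + f q.+1 <= a + b * q.+1%:R) ->
  forest_pot (pairing_round s) + level_count Q (pairing_round s)
  <= forest_pot s + level_count P s + a * (size s)%:R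
     + 4 * b * log2 (weights s).+1%:R + 1.
Proof.
move=> a0 b0 PQ fab.
have [N] := ubnP (size s); elim: N s => // N IHN [|t [|u s]] sN.
- by rewrite /forest_pot /= log2_1; lra.
- rewrite [pairing_round _]/=; set l := log2 _.
  have l0 : 0 <= b * l by rewrite mulr_ge0 // log2_nat_ge0.
  have := level_count_le_size Q [:: t]; have := level_count_ge0 P [:: t].
  by rewrite [size _]/=; lra.
rewrite [pairing_round _]/= !forest_pot_cons [level_count Q _]/=.
rewrite [level_count P _]/= -/(weights _) !weights_cons.
have /IHN : (size s < N)%N by move: sN => /=; lia.
rewrite !weights_round.
have [w [l [wl -> ->]]] := link_caseE t u.
have -> : (weight t + weight u + weights s).+1 = (weight t + weight u + (weights s).+1)%N by lia.
have -> : (weight t + (weight u + weights s)).+1 = (weight t + weight u + (weights s).+1)%N by lia.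
rewrite -addnS.
set E1 := ilog (_ + _ + (weights s).+1) (weight t).
set E2 := ilog (_ + _) (weight u).
set x := weight t in E1 E2 *; set y := weight u in E1 E2 *.
set z := (weights s).+1 in E1 E2 *.
have [v [Hv vE]] : exists v, ((ilog (x + y) (weight l) = ilog (x + y) x /\ v = E1) \/
   (ilog (x + y) (weight l) = ilog (x + y) y /\ v = E2)) /\
   (P v)%:R <= (P E1)%:R + (P E2)%:R :> R.
  have P1 : 0 <= (P E1)%:R :> R by [].
  have P2 : 0 <= (P E2)%:R :> R by [].
  by case: wl => -[_ ->]; [exists E2 | exists E1]; (split; [by [right|left] | lra]).
have := @link_weight_le x y z P Q a b (weight_gt0 t) (weight_gt0 u) isT a0 b0 PQ fab
  _ E1 E2 v Hv erefl erefl.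
rewrite [size _]/= -[(size s).+2%:R]natr1 -[(size s).+1%:R]natr1.
lra.
Qed.

Lemma weights_iter_round j s : weights (iter j (@pairing_round _ K) s) = weights s.
Proof. by elim: j => //= j IHj; rewrite weights_round. Qed.

Lemma size_iter_round j s :
  (size s <= 2 ^ j * size (iter j (@pairing_round _ K) s))%N.
Proof.
elim: j => [|j IHj] /=; first by rewrite mul1n.
apply: leq_trans IHj _; rewrite size_pairing_round uphalfE expnS -divn2.
set m := size _; have : (m <= 2 * (m.+1 %/ 2))%N by lia.
by rewrite -mulnA mulnCA leq_mul2l => ->; rewrite orbT.
Qed.

Lemma iter_round_stable j s : (size s <= 1)%N ->
  iter j (@pairing_round _ K) s = s.
Proof. by move=> s1; elim: j => //= j ->; case: s s1 => [|t []]. Qed.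

Lemma size_iter_round_le r j s : (size s <= 2 ^ (r + j))%N ->
  (size (iter r (@pairing_round _ K) s) <= 2 ^ j)%N.
Proof.
elim: r s => [|r IHr] s //; rewrite iterSr => sr; apply: IHr.
by rewrite size_pairing_round uphalfE -divn2; move: sr; rewrite addSn expnS; lia.
Qed.

(** Rounds on a single tree do nothing, so any sufficient number of rounds gives the same result. *)
Lemma multipassE r s : (size s <= 2 ^ r)%N ->
  multipass s = iter r (@pairing_round _ K) s.
Proof.
have stable m : (size s <= 2 ^ m)%N -> forall j,
    iter (j + m) (@pairing_round _ K) s = iter m (@pairing_round _ K) s.
  move=> sm j; rewrite iterD iter_round_stable //.
  by apply: (@size_iter_round_le m 0); rewrite addn0.
have sm : (size s <= 2 ^ size s)%N by exact/ltnW/ltn_expl.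
by move=> /stable sr; rewrite /multipass -(sr (size s)) addnC stable.
Qed.

(** * Several rounds with the crude bound on F *)

Section Rounds.
Variables (n : nat) (s0 : seq (tree K)).
Hypotheses (n2 : (1 < n)%N).
Let L : R := log2 n%:R.
Let lev := tower_level n.

Lemma log2_ge1 : 1 <= L.
Proof.
by have := le_log2_nat R n2; rewrite [X in X <= _ -> _](log2X R 1 : log2 2%:R = 1).
Qed.

(** The choice [a = 0], [b = 3]: no charge per tree. A round then costs at most 4 * 3 * L + 1 <= 13
    * L. *)
Lemma crude_weight q : 1 + f q.+1 <= 0 + 3 * q.+1%:R.
Proof.
have := logweight_le R q.+1; have : 1 <= q.+1%:R :> R by rewrite ler1n.
lra.
Qed.

Lemma early_rounds r s : (weights s).+1 = n ->
  forest_pot (iter r (@pairing_round _ K) s) <= forest_pot s + r%:R * (13 * L).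
Proof.
move=> sn; elim: r => [|r IHr] /=; first lra.
set s' := iter r _ s in IHr *.
have := @round_pot_le pred0 pred0 0 3 s' (lexx 0) (ler0n R 3) (fun _ _ _ => id) crude_weight.
rewrite !level_count_pred0 weights_iter_round sn -/L -natr1.
by have := log2_ge1; lra.
Qed.

(** The threshold falls by one level per round. At [j = 0] no log-ratio in a heap of size [n] passes
    it, at [j = lev.+1] all do; the count then equals the number of trees left, and the potential
    has dropped by that much up to the charges. *)
Let Q (j : nat) : pred nat := fun e => (lev < tower_level e + j)%N.

Lemma counted_rounds j s : (weights s).+1 = n ->
  forest_pot (iter j (@pairing_round _ K) s)
  + level_count (Q j) (iter j (@pairing_round _ K) s)
  <= forest_pot s + j%:R * (13 * L).
Proof.
move=> sn; elim: j => [|j IHj] /=.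
  suff -> : level_count (Q 0) s = 0 by lra.
  have : ((weights s).+1 <= n)%N by rewrite sn.
  elim: s {sn} => //= t s IHs sn; rewrite IHs ?addr0; last first.
    by move: sn; rewrite !weights_cons; lia.
  rewrite /Q addn0 ltnNge; set e := ilog _ _.
  suff -> : (tower_level e <= lev)%N by [].
  apply: leq_tower_level.
  have : (2 ^ e * weight t <= (weights (t :: s)).+1)%N.
    by apply: ilog_le; rewrite weight_gt0 /= weights_cons; lia.
  have := ltn_expl e (isT : 1 < 2)%N; have := weight_gt0 t; nia.
set s' := iter j _ s in IHj *.
have PQ e d : (tower_level e < tower_level d)%N -> Q j.+1 e -> Q j d.
  by rewrite /Q; lia.
have := @round_pot_le (Q j) (Q j.+1) 0 3 s' (lexx 0) (ler0n R 3) PQ crude_weight.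
rewrite weights_iter_round sn -/L -[j.+1%:R]natr1.
by have := log2_ge1; lra.
Qed.

Lemma count_full s : level_count (Q lev.+1) s = (size s)%:R.
Proof.
rewrite -level_count_predT; elim: s => //= t s ->; congr (_ + _).
by rewrite /Q addnS ltnS leq_addl.
Qed.

End Rounds.
End Potential.

Section DeleteMin.
Variables (R : realType) (disp : Order.disp_t) (K : orderType disp).
Implicit Type s : seq (tree K).
Local Notation f := (logweight R).
Local Notation round := (@pairing_round _ K).

(** * Rounds on at most about log n trees *)

Section LateRounds.
Variables (n tau : nat).
Hypotheses (n2 : (1 < n)%N).
Let L : R := log2 n%:R.
Hypothesis tauL : 2 ^+ tau <= 2 * L.
Let S m : R := \sum_(r < m) slope R (2 ^ r)%N.

(** With [t] rounds left, F is bounded by its tangent at [2 ^ sigma]. The charge per tree is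
    multiplied by at most [2 ^ t] trees, which halves each round and gives the geometric term. *)
Lemma late_rounds_sum t sigma s :
    (sigma + t = tau)%N -> (size s <= 2 ^ t)%N -> (weights s).+1 = n ->
  forest_pot R (iter t round s) <=
  forest_pot R s + 2 ^+ t.+1 * (1 + f (2 ^ sigma)%N)
  + 6 * L * (S tau - S sigma) + t%:R.
Proof.
elim: t sigma s => [|t IHt] sigma s.
  rewrite addn0 => -> _ _; rewrite /= expr1.
  by have := logweight_ge0 R (2 ^ tau)%N; lra.
move=> st ss sn; rewrite iterSr.
have stt : (sigma.+1 + t = tau)%N by rewrite addSn -addnS.
have s't : (size (pairing_round s) <= 2 ^ t)%N.
  by rewrite size_pairing_round uphalfE -divn2; move: ss; rewrite expnS; lia.
have s'n : (weights (pairing_round s)).+1 = n by rewrite weights_round.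
apply: le_trans (IHt _ _ stt s't s'n) _.
set v := (2 ^ sigma)%N.
have fab q : 1 + f q.+1 <= 1 + f v + slope R v * q.+1%:R.
  by have := logweight_le_tangent R v q.+1; lra.
have a0 : 0 <= 1 + f v by have := logweight_ge0 R v; lra.
have := @round_pot_le R _ K pred0 pred0 _ _ s a0 (slope_ge0 R v) (fun _ _ _ => id) fab.
rewrite !level_count_pred0 sn -/L.
have : (1 + f v) * (size s)%:R <= (1 + f v) * 2 ^+ t.+1.
  by rewrite ler_wpM2l // -natrX ler_nat.
have SE : S sigma.+1 = S sigma + slope R v by rewrite /S big_ord_recr.
(* Moving the tangent point from [v] to [2 * v] costs [slope v * 2 ^ tau], at most 2 * L times the
   slope; with the 4 * L of the round this makes 6 * L. *)
have := logweight_tangent R v v; rewrite addnn -mul2n -expnS.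
have vE : 2 ^+ t.+1 * v%:R = 2 ^+ tau :> R by rewrite natrX -exprD addnC st.
move=> /(ler_wpM2l (exprn_ge0 t.+1 (ler0n R 2))).
rewrite mulrDr mulrCA vE => H1 H2 H3.
have H4 : slope R v * 2 ^+ tau <= slope R v * (2 * L) by rewrite ler_wpM2l ?slope_ge0.
rewrite SE [2 ^+ t.+2]exprS -[t.+1%:R]natr1.
lra.
Qed.

Lemma late_rounds t s :
    (tau <= tower (tower_level n).+1)%N ->
    (t <= tau)%N -> (size s <= 2 ^ t)%N -> (weights s).+1 = n ->
  forest_pot R (iter t round s) <=
  forest_pot R s + 38 * L * (tower_level n).+1%:R.
Proof.
move=> tauT tt ss sn.
have st : (tau - t + t = tau)%N by rewrite subnK.
apply: le_trans (late_rounds_sum st ss sn) _.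
have := sum_slope_exp2 R tauT; rewrite -/(S tau).
have S0 : 0 <= S (tau - t)%N by apply: sumr_ge0 => r _; apply: slope_ge0.
have fb := logweight_le R (2 ^ (tau - t))%N.
have E : 2 ^+ t * (2 ^ (tau - t))%:R = 2 ^+ tau :> R by rewrite natrX -exprD subnKC.
have tb : t%:R <= 2 ^+ tau :> R.
  by rewrite -natrX ler_nat (leq_trans tt) //; apply/ltnW/ltn_expl.
have t2 : 2 ^+ t <= 2 ^+ tau :> R by rewrite ler_eXn2l // ltr1n.
have := ler_wpM2l (exprn_ge0 t (ler0n R 2)) fb; rewrite mulrCA E.
rewrite exprS -[(tower_level n).+2%:R]natr1.
have L1 := log2_ge1 R n2; rewrite -/L in L1.
set T := S tau; set T' := S _ in S0 *; set h : R := (tower_level n).+1%:R.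
have h1 : 1 <= h by rewrite ler1n.
move=> H1 H2.
have H3 : L * (T - T') <= L * (2 * (h + 1)) by apply: ler_wpM2l; lra.
have H4 : L <= L * h by rewrite ler_peMr //; lra.
(* The final estimate in plain variables: 4 + 8 from the geometric term, 2 from [t], and 24 from the
   slopes add up to 38. *)
have alg (P p F q T1 T2 tt' l h' : R) : p * F <= 2 * q -> p <= q -> tt' <= q ->
    q <= 2 * l -> l * (T1 - T2) <= l * (2 * (h' + 1)) -> l <= l * h' ->
  P + 2 * p * (1 + F) + 6 * l * (T1 - T2) + tt' <= P + 38 * l * h'.
  by lra.
exact: alg H1 t2 tb tauL H3 H4.
Qed.

End LateRounds.

(** Four times the charge 13 per early round, against the exponential decrease of the list. *)
Lemma mul52_le_exp2 r : (52 * r <= 2 ^ r + 256)%N.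
Proof.
elim: r => // r IHr; have [r6|] := ltnP 5 r; last by case: r IHr => [|[|[|[|[|[]]]]]].
have : (2 ^ 6 <= 2 ^ r)%N by rewrite leq_exp2l.
by rewrite (expnS 2 r); lia.
Qed.

(** Three phases. The first [h] rounds leave [G] trees and lower the potential by [G], up to 13 * L
    * h. Further rounds down to [2 ^ tau] trees cost at most G / 2 + 64 * L, and the last ones 38 *
    L * h. Half of [G] remains, and 13 + 64 + 38 = 115. *)
Lemma multipass_pot_le n s : (1 < n)%N -> (weights s).+1 = n ->
  forest_pot R (multipass s)
  + (size s)%:R / (4 * 2 ^+ tower_level n)
  <= forest_pot R s + 115 * log2 n%:R * (tower_level n).+1%:R.
Proof.
move=> n2 sn; set L := log2 n%:R.
have L1 : 1 <= L := log2_ge1 R n2.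
set h := (tower_level n).+1.
have h1 : 1 <= h%:R :> R by rewrite ler1n.
have Lh : L <= L * h%:R by rewrite ler_peMr //; lra.
set s1 := iter h round s; set G := size s1.
have sG : (size s <= 2 ^ h * G)%N := size_iter_round h s.
have s1n : (weights s1).+1 = n by rewrite weights_iter_round.
have c1 := counted_rounds R n2 h sn; rewrite count_full -/s1 -/L -/G in c1.
have G0 : (0 < G)%N.
  by move: sG sn n2; case: (G) => //; rewrite muln0 leqn0 => /nilP -> /= <-.
(* Chosen so that [L <= 2 ^ tau <= 2 * L]. *)
set l := trunc_log 2 n; set tau := (trunc_log 2 l).+1.
have n0 : (0 < n)%N by lia.
have l0 : (0 < l)%N by rewrite /l trunc_log_gt0 n2.
have ln : (2 ^ l <= n)%N by apply: trunc_logP.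
have nl : (n < 2 ^ l.+1)%N by apply: trunc_log_ltn.
have taul : (2 ^ tau <= 2 * l)%N by rewrite expnS leq_mul2l /=; apply: trunc_logP.
have ltau : (l < 2 ^ tau)%N by apply: trunc_log_ltn.
have lL : l%:R <= L by rewrite -log2X log2_le ?exprn_gt0 // -natrX ler_nat.
have Ll : L <= l.+1%:R by rewrite -log2X log2_le ?ltr0n // -natrX ler_nat ltnW.
have tauL : 2 ^+ tau <= 2 * L.
  apply: (@le_trans _ _ (2 * l%:R)); last by rewrite ler_pM2l.
  by rewrite -natrX -(natrM _ 2) ler_nat.
have Ltau : L <= 2 ^+ tau by apply: le_trans Ll _; rewrite -natrX ler_nat.
have tauT : (tau <= tower h)%N.
  apply/ltnW/(leq_ltn_trans _ (tower_level_lt n)).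
  have := ltn_expl l (isT : 1 < 2)%N; have := ltn_expl tau.-1 (isT : 1 < 2)%N.
  by move: taul; rewrite /tau /= expnS; lia.
set r := (trunc_log 2 G).+1.
have rG : (2 ^ r <= 2 * G)%N by rewrite expnS leq_mul2l /=; apply: trunc_logP.
have Gr : (G < 2 ^ r)%N by apply: trunc_log_ltn.
have -> : multipass s = iter r round s1.
  rewrite (@multipassE _ K (r + h)) ?iterD //.
  by apply: leq_trans sG _; rewrite expnD mulnC leq_mul2r ltnW ?orbT.
have kG : (size s)%:R / (4 * 2 ^+ tower_level n) <= G%:R / 2 :> R.
  rewrite ler_pdivrMr ?mulr_gt0 ?exprn_gt0 //.
  rewrite -natrX mulrAC mulrA ler_pdivlMr // -!natrM ler_nat.
  by move: sG; rewrite /h expnS; lia.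
suff : forest_pot R (iter r round s1) <= forest_pot R s1
    + G%:R / 2 + (64 * L + 38 * L * h%:R) by lra.
(* If [G] is already small, the middle phase is empty. *)
have [rtau|taur] := leqP r tau.
  have := late_rounds n2 tauL tauT rtau (ltnW Gr) s1n; rewrite -/L -/h.
  by have := ler0n R G; lra.
have qt : (r - tau + tau)%N = r by rewrite subnK // ltnW.
have -> : r = (tau + (r - tau))%N by rewrite addnC qt.
set q := (r - tau)%N in qt *; rewrite iterD; set s2 := iter q _ _.
have s2n : (weights s2).+1 = n by rewrite weights_iter_round.
have s2t : (size s2 <= 2 ^ tau)%N.
  by apply: size_iter_round_le; rewrite qt; apply: ltnW Gr.
have := late_rounds n2 tauL tauT (leqnn tau) s2t s2n; rewrite -/L -/h.
have := early_rounds R n2 q s1n; rewrite -/s2 -/L.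
suff : q%:R * (13 * L) <= G%:R / 2 + 64 * L by lra.
have G2 : L * 2 ^+ q <= 2 * G%:R.
  apply: (@le_trans _ _ (2 ^+ tau * 2 ^+ q)); first by rewrite ler_wpM2r ?exprn_ge0.
  by rewrite -exprD addnC qt -natrX -(natrM _ 2) ler_nat.
have : L * (52 * q%:R) <= L * (2 ^+ q + 256).
  apply: ler_wpM2l; first lra.
  by rewrite -natrX -(natrM _ 52) -(natrD _ _ 256) ler_nat mul52_le_exp2.
lra.
Qed.

End DeleteMin.

(** * A slowly growing scaling factor *)

Section Amplifier.
Variable R : realType.

(* A continuous version of [2 ^+ tower_level n]: the latter doubles at every
   tower, and a single insertion could not pay for doubling the potential. *)
Definition amp (n : nat) : R :=
  Num.max (2 ^+ tower_level n)
    (2 ^+ (tower_level n).+1 * (n%:R / (tower (tower_level n).+1)%:R)).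

Lemma amp_ge n : 2 ^+ tower_level n <= amp n.
Proof. by rewrite /amp le_max lexx. Qed.

Lemma amp_le n : amp n <= 2 * 2 ^+ tower_level n.
Proof.
have p0 : 0 <= 2 ^+ tower_level n :> R by rewrite exprn_ge0.
rewrite /amp ge_max -exprS ler_piMr ?exprn_ge0 //; last first.
  by rewrite ler_pdivrMr ?ltr0n ?tower_gt0 // mul1r ler_nat ltnW // tower_level_lt.
by rewrite exprS ler_peMl // ler1n.
Qed.

Lemma amp_gt0 n : 0 < amp n.
Proof. by apply: lt_le_trans (amp_ge n); rewrite exprn_gt0. Qed.

(** The linear piece has slope [2 * p / tower j.+1], at most [2 * p / n]. As [pot] is O(n log n),
    the growth of the factor costs an insertion only O(p log n). *)
Lemma amp_step n : (0 < n)%N ->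
  amp n <= amp n.+1 /\ (amp n.+1 - amp n) * n%:R <= 2 * 2 ^+ tower_level n.
Proof.
move=> n0; set j := tower_level n; set p : R := 2 ^+ j.
have p0 : 0 < p by rewrite exprn_gt0.
have n0R : 0 < n%:R :> R by rewrite ltr0n.
have nT := tower_level_lt n; rewrite -/j in nT.
have [nT'|Tn] := ltnP n.+1 (tower j.+1).
  have lev : tower_level n.+1 = j.
    apply/eqP; rewrite eqn_leq tower_level_min //=.
    exact: leq_tower_level.
  rewrite /amp lev -/j exprS -/p; set T : R := (tower j.+1)%:R.
  have T0 : 0 < T by rewrite ltr0n tower_gt0.
  have nT1 : n%:R <= T by rewrite ler_nat ltnW.
  have cn : n.+1%:R / T = n%:R / T + T^-1 by rewrite -natr1 mulrDl mul1r.
  have c0 : 0 < T^-1 by rewrite invr_gt0.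
  have nc : T^-1 * n%:R <= 1 by rewrite mulrC ler_pdivrMr // mul1r.
  have pc : 0 < p * T^-1 by rewrite mulr_gt0.
  have pnc : p * (T^-1 * n%:R) <= p * 1 by rewrite ler_wpM2l // ltW.
  rewrite cn; set q := n%:R / T.
  have mono : Num.max p (2 * p * (q + T^-1)) <= Num.max p (2 * p * q) + 2 * p * T^-1.
    rewrite ge_max; apply/andP; split.
      have : p <= Num.max p (2 * p * q) by rewrite le_max lexx.
      lra.
    have : 2 * p * q <= Num.max p (2 * p * q) by rewrite le_max lexx orbT.
    lra.
  split.
    rewrite ge_max le_max lexx /= le_max; apply/orP; right; lra.
  apply: (@le_trans _ _ (2 * p * T^-1 * n%:R)); last lra.
  by rewrite ler_wpM2r //; lra.
(* At the next tower the linear piece reaches [2 * p], exactly where the constant piece of the new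
   level starts. *)
have nE : n.+1 = tower j.+1 by apply/eqP; rewrite eqn_leq nT Tn.
have lev : tower_level n.+1 = j.+1.
  apply/eqP; rewrite eqn_leq; apply/andP; split.
    by apply: tower_level_min; rewrite {1}nE /= ltn_expl.
  by rewrite ltnNge; apply/negP => /tower_level_ltP; rewrite nE ltnn.
have ampS : amp n.+1 = 2 * p.
  rewrite /amp lev -exprS; apply/max_idPl; rewrite [X in X * _ <= _]exprS.
  rewrite mulrAC ler_piMl ?exprn_ge0 // mulrA ler_pdivrMr ?ltr0n ?tower_gt0 //.
  rewrite mul1r -(natrM _ 2) ler_nat {1}nE -[tower j.+2]/(2 ^ tower j.+1)%N.
  have : (tower j.+1 <= 2 ^ (tower j.+1).-1)%N.
    by have := ltn_expl (tower j.+1).-1 (isT : 1 < 2)%N; have := tower_gt0 j.+1; lia.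
  by case: (tower j.+1) (tower_gt0 j.+1) => //= m _; rewrite expnS; lia.
rewrite ampS; split; first exact: amp_le.
have H : 2 * p * (n%:R / n.+1%:R) <= amp n.
  by rewrite /amp -/j nE exprS le_max lexx orbT.
have nn : n%:R / n.+1%:R = 1 - n.+1%:R^-1 :> R.
  by rewrite -[X in X / _](addrK 1) natr1 mulrBl divff ?mul1r // pnatr_eq0.
have c0 : 0 < n.+1%:R^-1 :> R by rewrite invr_gt0 ltr0n.
have nc : n.+1%:R^-1 * n%:R <= 1 :> R.
  by rewrite mulrC ler_pdivrMr ?ltr0n // mul1r ler_nat.
rewrite nn in H; set c := n.+1%:R^-1 in H c0 nc.
apply: (@le_trans _ _ (2 * p * c * n%:R)).
  by rewrite ler_wpM2r //; lra.
by rewrite -mulrA ler_piMr //; lra.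
Qed.

Lemma amp_mono m n : (0 < m <= n)%N -> amp m <= amp n.
Proof.
move=> /andP[m0 /subnK <-]; elim: (n - m)%N => //= k IHk.
by apply: le_trans IHk _; rewrite addSn; have [] := amp_step (ltn_addl k m0).
Qed.

End Amplifier.

(** * The potential of heaps and the amortized costs *)

Section HeapPotential.
Variables (R : realType) (disp : Order.disp_t) (K : orderType disp).
Implicit Types (t : tree K) (h : option (tree K)).

(** The drop of k / (4 * 2 ^ level) in a deletion, scaled by [8 * amp], pays for the actual cost
    k. *)
Definition heap_pot h : R :=
  if h is Some t then 8 * amp R (weight t) * pot R t else 0.

Lemma heap_pot_ge0 h : 0 <= heap_pot h.
Proof.
by case: h => //= t; rewrite mulr_ge0 ?pot_ge0 // mulr_ge0 // ltW // amp_gt0.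
Qed.

Lemma delete_min_bound_ge0 n : 0 <= delete_min_bound R n.
Proof. by rewrite /delete_min_bound mulr_ge0 ?exprn_ge0 // mulr_ge0 ?log2_nat_ge0. Qed.

Lemma delete_min_bound_ge n : (1 < n)%N ->
  2 ^+ tower_level n * log2 n%:R * (tower_level n).+1%:R
  <= 2 * delete_min_bound R n.
Proof.
move=> n2; have l1 := log2_ge1 R n2; have n0 := ltnW n2.
have lev := tower_level_le_log_star R n0; have ls := log_star_gt0 R n2.
rewrite /delete_min_bound.
move: (log2 _) (tower_level n) (log_star R n) l1 lev ls => l j k l1 jk k0.
have -> : 2 * (l * k%:R * 2 ^+ k) = 2 ^+ k * l * (2 * k%:R) by ring.
have l0 : 0 <= l by lra.
apply: ler_pM => //; first by rewrite mulr_ge0 ?exprn_ge0.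
  by rewrite ler_wpM2r // ler_weXn2l // ler1n.
by rewrite -(natrM _ 2) ler_nat; lia.
Qed.

(** An insertion creates one log-ratio, of weight at most 2 * (1 + L), and raises the factor on the
    old potential; both cost O(p * (1 + L)). *)
Lemma heap_pot_insert (x : K) h :
  amortized_cost heap_pot 1 h (insert x h)
    <= 3680 * (1 + delete_min_bound R (size (heap_keys h))).
Proof.
rewrite /amortized_cost; case: h => [t|] /=; last first.
  by have := delete_min_bound_ge0 0; rewrite mulr0; lra.
rewrite -/(weight t); set n := weight t.
have [w [l [wl -> ->]]] := link_caseE R (Node x [::]) t.
have n0 : (0 < n)%N := weight_gt0 t.
rewrite [weight (Node _ _)]/= -/n add1n [pot R (Node _ _)]/= addr0.
set d := logweight R _; set L : R := log2 n%:R.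
have L0 : 0 <= L := log2_nat_ge0 R n.
have dL : d <= 2 * (1 + L).
  apply: le_trans (logweight_le R _) _; rewrite ler_pM2l //.
  apply: le_trans (log2_succ_le R n0); apply: ilog_le_log2 => //.
  by case: wl => -[_ ->]; rewrite ?weight_gt0 //= -/n; lia.
have d0 : 0 <= d := logweight_ge0 R _.
set p : R := 2 ^+ tower_level n.
have p1 : 1 <= p by rewrite exprn_ege1 // ler1n.
have [a1 a2] := amp_step R n0; rewrite -/p in a2.
have a3 := amp_le R n; rewrite -/p in a3.
have n1R : 1 <= n%:R :> R by rewrite ler1n.
set a := amp R n in a1 a2 a3 *; set a' := amp R n.+1 in a1 a2 *.
have a4 : a' <= 4 * p.
  have : (a' - a) * 1 <= (a' - a) * n%:R by rewrite ler_wpM2l // subr_ge0.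
  lra.
have v0 := pot_ge0 R t; have vL := pot_le R t; rewrite -/n -/L in vL.
set v := pot R t in v0 vL *.
have H1 : a' * d <= 4 * p * (2 * (1 + L)).
  by apply: ler_pM => //; have := amp_gt0 R n.+1; rewrite -/a'; lra.
have H2 : (a' - a) * v <= 2 * p * (2 * L).
  apply: (@le_trans _ _ ((a' - a) * (2 * n%:R * L))).
    by rewrite ler_wpM2l // subr_ge0.
  have -> : (a' - a) * (2 * n%:R * L) = (a' - a) * n%:R * (2 * L) by ring.
  by rewrite ler_wpM2r //; lra.
have B0 := delete_min_bound_ge0 n.
suff : p * L + p <= 1 + 4 * delete_min_bound R n by lra.
(* For [n = 1] the bound vanishes and the additive 1 pays. *)
have [n2|n1] := ltnP 1 n.
  have p0 : 0 <= p by lra.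
  have := delete_min_bound_ge n2; rewrite -/L -/p.
  have : p * L * 1 <= p * L * (tower_level n).+1%:R.
    by apply: ler_wpM2l; [exact: mulr_ge0 | rewrite ler1n].
  have : p * 1 <= p * L by rewrite ler_wpM2l // log2_ge1.
  lra.
have n1E : n = 1%N by lia.
have -> : p = 1.
  have : (tower_level n <= 0)%N by apply: tower_level_min; rewrite n1E.
  by rewrite leqn0 /p => /eqP ->.
rewrite /L n1E log2_1; have := delete_min_bound_ge0 1; lra.
Qed.

(** 3680 = 8 * 115 * 2 * 2: the scaling, the forest bound, [amp_le] and [delete_min_bound_ge]. *)
Lemma heap_pot_delete_min t :
  amortized_cost heap_pot (delete_min_cost t) (Some t) (delete_min t)
    <= 3680 * delete_min_bound R (size (keys t)).
Proof.
rewrite /amortized_cost -/(weight t) /delete_min_cost /delete_min.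
set n := weight t; set s := children t.
have sn : (weights s).+1 = n by rewrite -weightE.
have B0 := delete_min_bound_ge0 n.
have [n2|n1] := ltnP 1 n; last first.
  have -> : s = [::].
    by case: s sn => // u s'; rewrite weights_cons; have := weight_gt0 u; lia.
  by rewrite /=; have := heap_pot_ge0 (Some t); rewrite /=; lra.
have main := multipass_pot_le R n2 sn.
have := weights_iter_round R (size s) s; rewrite -/(multipass s) => ws.
have : size (multipass s) = 1%N.
  by rewrite size_multipass lt0n; case: (s) sn n2 => //= <-.
case: (multipass s) main ws => [|r []] // main ws _.
rewrite [heap_pot _]/= [heap_pot (Some t)]/=.
have rE : (weight r).+1 = n by rewrite -sn -ws /weights /= addn0.
(* The forest potential still counts the log-ratio of [r] below the deleted root. *)
have r0 : pot R r <= forest_pot R [:: r].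
  rewrite forest_pot_cons /forest_pot /= addr0.
  by have := logweight_ge0 R (ilog (weights [:: r]).+1 (weight r)); rewrite /=; lra.
have aa : amp R (weight r) <= amp R n.
  by apply: amp_mono; rewrite weight_gt0 -rE leqnSn.
rewrite -/n (potE R t) -/s.
have := delete_min_bound_ge n2.
have a1 := amp_ge R n; have a2 := amp_le R n.
set p : R := 2 ^+ tower_level n in main a1 a2 *; set a := amp R n in aa a1 a2 *.
set L : R := log2 _ in main *; set h : R := (tower_level n).+1%:R in main *.
have p0 : 0 < p by rewrite exprn_gt0.
have H0 : 8 * amp R (weight r) * pot R r <= 8 * a * pot R r.
  by rewrite ler_wpM2r ?pot_ge0 // ler_pM2l.
set k : R := (size s)%:R in main *.
have H1 : 8 * a * (pot R r + k / (4 * p)) <= 8 * a * (forest_pot R s + 115 * L * h).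
  by rewrite ler_wpM2l //; lra.
have H2 : k <= 8 * a * (k / (4 * p)).
  have -> : 8 * a * (k / (4 * p)) = k * (2 * a / p) by field; rewrite gt_eqF.
  by rewrite ler_peMr // ler_pdivlMr //; lra.
have H3 : a * (L * h) <= 2 * p * (L * h).
  by rewrite ler_wpM2r // mulr_ge0 // log2_nat_ge0.
lra.
Qed.

End HeapPotential.

Theorem theorem15 (R : realType) :
  exists C : R,
    forall (disp : Order.disp_t) (K : orderType disp),
      exists Phi : option (tree K) -> R,
        admissible_potential Phi C /\
        forall t : tree K, is_heap t ->
          amortized_cost Phi (delete_min_cost t) (Some t) (delete_min t)
            <= C * delete_min_bound R (size (keys t)).
Proof.
exists 3680 => disp K; exists (@heap_pot R disp K); split; last first.
  by move=> t _; apply: heap_pot_delete_min.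
split => // [h _|x h _ _]; first exact: heap_pot_ge0.
exact: heap_pot_insert.
Qed.
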